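(* Let $n \ge 7$ and let $p\in[0,1]$ satisfy $p \ge \kappa\log^3(n)/n$, where $\kappa = 2\times 835^2$. Let $v_p$ denote an eigenvector corresponding to the largest eigenvalue $\lambda_p$ of $A_p$ with $\|v_p\|_2=1$. Then, with probability at least $$1 - 4(n - 1)\exp\left(-2c\left(\frac{\log(np)}{\log n}\right)^2(n - 1)p\right),\qquad c=\frac{1}{9408},$$ one has $$\left\|v_p\right\|_{\infty} \le \frac{11}{\sqrt{n}}.$$
   Context: For a positive integer $n$, let $(U_{i,j})_{1\le i<j\le n}$ be independent random variables uniformly distributed on $[0,1]$. For $p\in[0,1]$, the adjacency matrix $A_p$ of the Erdős–Rényi random graph $G(n,p)$ is the symmetric $n\times n$ matrix with zero diagonal and with entries $A^{(p)}_{i,j}=A^{(p)}_{j,i}=\mathbf{1}_{U_{i,j}<p}$ for $1\le i<j\le n$. $\|\cdot\|_2$ is the Euclidean norm and $\|\cdot\|_\infty$ the maximum norm on $\mathbb{R}^n$. $\log$ is the natural logarithm and $\log^3(n)=(\log n)^3$. *)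

(* Defs.v *)
From HB Require Import structures.
From mathcomp Require Export all_boot all_order all_algebra.
From mathcomp Require Export all_classical all_reals all_analysis.
Export numFieldNormedType.Exports.

Set Implicit Arguments.
Unset Strict Implicit.
Unset Printing Implicit Defensive.

Import Order.TTheory GRing.Theory Num.Theory.

Local Open Scope classical_set_scope.
Local Open Scope ring_scope.

(* Joint independence of the subfamily (X i), i \in D: the product rule is
   required on every finite J included in D. *)
Definition independent_on (d : measure_display) (T : measurableType d)
    (R : realType) (P : probability T R) (I : finType) (D : {pred I})
    (X : I -> {RV P >-> R}) : Prop :=
  forall (J : {set I}) (B : I -> set (measurableTypeR R)),
    {subset J <= D} -> (forall i, i \in J -> measurable (B i)) ->
    P (\bigcap_(i in [set` J]) (X i @^-1` B i)) =
      (\prod_(i in J) P (X i @^-1` B i))%E.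

Definition uniform01 (d : measure_display) (T : measurableType d)
    (R : realType) (P : probability T R) (X : {RV P >-> R}) : Prop :=
  forall B : set (measurableTypeR R), measurable B ->
    distribution P X B = uniform_prob (@ltr01 R) B.

Definition upper_pairs (n : nat) : {pred 'I_n * 'I_n} :=
  [pred ij : 'I_n * 'I_n | (ij.1 < ij.2)%N].

(* Only the values of u on upper_pairs n are used. *)
Definition adjacency (R : realType) (n : nat) (p : R) (u : 'I_n * 'I_n -> R) :
    'M[R]_n :=
  \matrix_(i, j)
    (if (i < j)%N then (u (i, j) < p)%R%:R
     else if (j < i)%N then (u (j, i) < p)%R%:R
     else 0).

Definition largest_eigenvalue (R : realType) (n : nat) (A : 'M[R]_n) (l : R) :
    Prop :=
  eigenvalue A l /\ forall m : R, eigenvalue A m -> m <= l.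

(* The maximum norm needs no definition: it is the norm `|v| of 'cV[R]_n. *)
Definition norm2 (R : realType) (n : nat) (v : 'cV[R]_n) : R :=
  Num.sqrt (\sum_i v i 0 ^+ 2).

(* For n > 0 a unit vector is nonzero, hence v is a genuine eigenvector. The
   library's eigenvalue refers to left (row) eigenvectors, which for the
   symmetric matrices considered here makes no difference. *)
Definition unit_top_eigenvector (R : realType) (n : nat) (A : 'M[R]_n)
    (v : 'cV[R]_n) : Prop :=
  norm2 v = 1 /\ exists2 l : R, largest_eigenvalue A l & A *m v = l *: v.

(* Main.v *)
Require Import Defs.
From mathcomp Require Import ring lra.

(** Write mu = (n-1)p, L = ln(np)/ln n, delta = L/32 and rho = (np)^(1/6).
    The proof splits into a deterministic part and a union bound.

    Deterministic part.  Call a graph quasirandom if all degrees lie within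
    (1 +- delta) mu and, for all vertex sets S and T, the number e(S,T) of
    edges between them is at most
    3 p |S||T| + (mu / (5 rho)) sqrt(|S||T|).
    Let v be a unit top eigenvector and u = |v|.  The top eigenvalue is at
    least the average degree ([rayleigh_le_largest_eigenvalue]), so u is
    subinvariant: (1 - delta) mu u <= A u entrywise.  Let M be the maximum of
    u, q = 1 - 4 delta, and S_a the level set where u >= M q^a.  The vertices
    of S_a have degree at most (1 + delta) mu, so they can satisfy the
    subinvariance only if they send many edges to vertices above the level
    M q^(a+1); by the edge bound these vertices cannot be packed into a small
    set, so the level sets grow by the factor rho^2 per step until they reach
    size n/30 ([level_set_step]).  This takes at most k steps, k being about
    3/L, and q^k >= 1/2 because 4 delta k <= 1/2.  Hence
    u >= M/2 on n/30 vertices, and 1 = |u|_2^2 >= (n/30)(M/2)^2 gives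
    M^2 <= 120/n <= 121/n ([subinvariant_delocalized],
    [quasirandom_delocalized]).

    Probabilistic part.  The graph is a random set of pairs, each pair being
    present independently with probability p ([threshold_set_law]); a single
    exponential moment estimate ([rset_chernoff]) controls everything.  Each
    of the 2n degree conditions fails with probability at most
    exp(- delta^2 mu / 4) = exp(- L^2 mu / 4096).  The edge bound can only
    fail for sets with sqrt(|S||T|) >= mu / (5 rho) and with
    |S| + |T| <= 20 rho sqrt(|S||T|)
    ([discrepancy_violation_sizes]), and for such sets the failure probability
    exp(- (mu / (30 rho)) sqrt(|S||T|)) beats both the number of pairs of sets
    and exp(- mu) ([discrepancy_tail]).  The lower bound on p
    is what makes mu large compared with rho^2 ln n ([sparse_regime]). *)

Set Implicit Arguments.
Unset Strict Implicit.
Unset Printing Implicit Defensive.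

Import Order.TTheory GRing.Theory Num.Theory.

Local Open Scope classical_set_scope.
Local Open Scope ring_scope.

(** * Random subsets with independent memberships *)

(** The law of the random subset of [I] that contains each [i] independently
    with probability [pi i]. *)
Definition rset_wt (R : realType) (I : finType) (pi : I -> R) (J : {set I}) : R :=
  \prod_i (if i \in J then pi i else 1 - pi i).

Definition rset_pr (R : realType) (I : finType) (pi : I -> R)
    (Q : pred {set I}) : R :=
  \sum_(J : {set I} | Q J) rset_wt pi J.

Lemma rset_wt_ge0 (R : realType) (I : finType) (pi : I -> R) (J : {set I}) :
  (forall i, 0 <= pi i <= 1) -> 0 <= rset_wt pi J.
Proof.
move=> pi01; apply: prodr_ge0 => i _.
by case/andP: (pi01 i) => p0 p1; case: ifP => // _; rewrite subr_ge0.
Qed.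

Lemma rset_wt_prod (R : realType) (I : finType) (pi z : I -> R) :
  \sum_(J : {set I}) rset_wt pi J * \prod_(i in J) z i =
  \prod_i (pi i * z i + (1 - pi i)).
Proof.
rewrite bigA_distr; apply: eq_bigr => J _.
rewrite /rset_wt [X in _ * X]big_mkcond -big_split /=.
by apply: eq_bigr => i _; case: ifP => // _; rewrite mulr1.
Qed.

Lemma rset_wt_sum1 (R : realType) (I : finType) (pi : I -> R) :
  \sum_(J : {set I}) rset_wt pi J = 1.
Proof.
have := rset_wt_prod pi (fun=> 1); rewrite [RHS]big1 => [<-|i _].
  by apply: eq_bigr => J _; rewrite big1 ?mulr1.
by rewrite mulr1 addrC subrK.
Qed.

Lemma rset_pr_le (R : realType) (I : finType) (pi : I -> R)
    (Q Q' : pred {set I}) :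
  (forall i, 0 <= pi i <= 1) -> (forall J, Q J -> Q' J) ->
  rset_pr pi Q <= rset_pr pi Q'.
Proof.
move=> pi01 QQ'; rewrite /rset_pr big_mkcond [leRHS]big_mkcond /=.
apply: ler_sum => J _; case: ifP => [/QQ' ->//|_].
by case: ifP => // _; exact: rset_wt_ge0.
Qed.

Lemma rset_prC (R : realType) (I : finType) (pi : I -> R)
    (Q : pred {set I}) :
  rset_pr pi Q = 1 - rset_pr pi (predC Q).
Proof. by rewrite -(rset_wt_sum1 pi) (bigID Q) /= addrK. Qed.

Lemma rset_pr_union (R : realType) (I K : finType) (pi : I -> R)
    (Q : K -> pred {set I}) :
  (forall i, 0 <= pi i <= 1) ->
  rset_pr pi (fun J => [exists k, Q k J]) <= \sum_k rset_pr pi (Q k).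
Proof.
move=> pi01; rewrite /rset_pr; under [leRHS]eq_bigr do rewrite big_mkcond.
rewrite exchange_big /= big_mkcond; apply: ler_sum => J _.
have h k : 0 <= (if Q k J then rset_wt pi J else 0).
  by case: ifP => // _; exact: rset_wt_ge0.
case: ifP => [/existsP[k Qk]|_]; last by apply: sumr_ge0.
by rewrite (bigD1 k) //= Qk lerDl sumr_ge0.
Qed.

Lemma rset_prU (R : realType) (I : finType) (pi : I -> R)
    (Q Q' : pred {set I}) :
  (forall i, 0 <= pi i <= 1) ->
  rset_pr pi (predU Q Q') <= rset_pr pi Q + rset_pr pi Q'.
Proof.
move=> pi01; rewrite /rset_pr big_mkcond.
rewrite [X in _ <= X + _]big_mkcond [X in _ <= _ + X]big_mkcond -big_split.
apply: ler_sum => J _ /=; have w0 := rset_wt_ge0 J pi01.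
by case: (Q J); case: (Q' J) => /=; rewrite ?addr0 ?add0r // lerDl.
Qed.

(** Only 1 + x <= exp x is used: exp t = exp(-t/2)^-2 <= (1 - t/2)^-2, and the
    latter is below the quadratic as long as 1 - 3t + t^2 >= 0. *)
Lemma expR_le_quadratic (R : realType) (t : R) :
  t <= 1 / 3 -> expR t <= 1 + t + t ^+ 2.
Proof.
move=> t3.
have h : 0 < 1 - t / 2 by lra.
have e2 : expR t = (expR (- (t / 2)) ^+ 2)^-1.
  by rewrite -expRM_natl -expRN; congr expR; field.
have lb : (1 - t / 2) ^+ 2 <= expR (- (t / 2)) ^+ 2.
  rewrite lerXn2r ?nnegrE ?expR_ge0 //; first exact: ltW.
  by have := expR_ge1Dx (- (t / 2)).
rewrite e2; apply: (@le_trans _ _ ((1 - t / 2) ^+ 2)^-1).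
  by rewrite lef_pV2 // posrE exprn_gt0 // expR_gt0.
rewrite -[leLHS]mul1r ler_pdivrMr ?exprn_gt0 //.
have -> : (1 + t + t ^+ 2) * (1 - t / 2) ^+ 2 =
  1 + t ^+ 2 / 4 * (1 - 3 * t + t ^+ 2) by field.
rewrite lerDl mulr_ge0 //; first by rewrite divr_ge0 ?sqr_ge0.
by have := sqr_ge0 t; lra.
Qed.

(** Chernoff's bound by the exponential moment of t |J :&: F|.  The parameter
    [t] is signed, so positive [t] yields upper tails and negative [t] lower
    tails. *)
Lemma rset_chernoff (R : realType) (I : finType) (pi : I -> R) (F : {set I})
    (Q : pred {set I}) (t a : R) :
  (forall i, 0 <= pi i <= 1) -> t <= 1 / 3 ->
  (forall J, Q J -> a <= t * #|J :&: F|%:R) ->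
  rset_pr pi Q <= expR (- a + (t + t ^+ 2) * \sum_(i in F) pi i).
Proof.
move=> pi01 t3 Qa.
pose z i := if i \in F then expR t else 1.
have zE (J : {set I}) : \prod_(i in J) z i = expR (t * #|J :&: F|%:R).
  rewrite expRM_natr -prodr_const [LHS]big_mkcond [RHS]big_mkcond /=.
  by apply: eq_bigr => i _; rewrite inE /z; case: (i \in J).
rewrite expRD expRN mulrC -ler_pdivrMr ?invr_gt0 ?expR_gt0 // invrK.
apply: (@le_trans _ _ (\sum_(J : {set I}) rset_wt pi J * \prod_(i in J) z i)).
  rewrite /rset_pr mulr_suml big_mkcond; apply: ler_sum => J _.
  rewrite zE; have w0 := rset_wt_ge0 J pi01.
  case: ifP => [/Qa QJ|_]; last by rewrite mulr_ge0 // expR_ge0.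
  by rewrite ler_wpM2l // ler_expR.
rewrite rset_wt_prod mulr_sumr expR_sum [leRHS]big_mkcond /=.
apply: ler_prod => i _; case/andP: (pi01 i) => p0 p1.
rewrite addr_ge0 ?subr_ge0 ?mulr_ge0 //=; last first.
  by rewrite /z; case: ifP => // _; exact: expR_ge0.
rewrite /z; case: ifP => [_|_]; last by rewrite mulr1 addrC subrK.
apply: le_trans (expR_ge1Dx _).
have := ler_wpM2l p0 (expR_le_quadratic t3); lra.
Qed.

(** * Thresholding independent uniform variables *)

Lemma uniform_prob_lt (R : realType) (p : R) :
  0 <= p <= 1 -> uniform_prob (@ltr01 R) `]-oo, p[%classic = p%:E.
Proof.
move=> /andP[p0 p1]; rewrite /uniform_prob integral_uniform_pdf.
have -> : `]-oo, p[%classic `&` `[0, 1]%classic = `[0, p[%classic :> set R.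
  apply/seteqP; split => x /=; rewrite !in_itv /=.
    by move=> [xp /andP[x0 _]]; rewrite x0.
  by move=> /andP[x0 xp]; split; rewrite // x0 /= (le_trans (ltW xp)).
rewrite (eq_integral (fun=> 1%:E)); last first.
  move=> x; rewrite inE /= in_itv /= => /andP[x0 xp].
  by rewrite /uniform_pdf x0 (le_trans (ltW xp)) // subr0 invr1.
rewrite integral_cst //= mul1e lebesgue_measure_itv /= lte_fin.
case: ltP => [_|p0']; first by rewrite oppr0 adde0.
by congr EFin; apply/eqP; rewrite eq_le p0.
Qed.

(** Transfers every question about the thresholded family to a finite sum.
    Measurability and law come together because the event is a finite disjoint
    union of intersections of half-line events, one intersection for each value
    of the random set. *)
Lemma threshold_set_law (d : measure_display) (T : measurableType d)
    (R : realType) (P : probability T R) (I : finType) (D : {pred I})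
    (X : I -> {RV P >-> R}) (p : R) (Q : pred {set I}) :
  0 <= p <= 1 -> independent_on D X ->
  (forall i, i \in D -> uniform01 (X i)) ->
  let E w := [set i in D | X i w < p]%SET in
  measurable [set w | Q (E w)] /\
  P [set w | Q (E w)] = (rset_pr (fun i => if i \in D then p else 0) Q)%:E.
Proof.
move=> p01 indep unif E.
pose B (J : {set I}) i : set (measurableTypeR R) :=
  if i \in J then `]-oo, p[%classic else ~` `]-oo, p[%classic.
have mp : measurable (`]-oo, p[%classic : set (measurableTypeR R)).
  exact: measurable_itv.
have mB J i : measurable (B J i).
  by rewrite /B; case: ifP => _ //; exact: measurableC.
have mXB J i : measurable (X i @^-1` B J i).
  exact: (measurable_funPTI (X i) (mB J i)).
have PXB J i : i \in D ->
    P (X i @^-1` B J i) = (if i \in J then p else 1 - p)%:E.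
  move=> iD.
  have Plt : P (X i @^-1` `]-oo, p[%classic) = p%:E.
    by have := unif i iD _ mp; rewrite uniform_prob_lt.
  rewrite /B; case: ifP => _ //.
  rewrite preimage_setC probability_setC ?Plt //.
  exact: (measurable_funPTI (X i) mp).
pose DS := [set i in D]%SET.
have EJ (J : {set I}) : J \subset DS ->
    [set w | E w = J] = \bigcap_(i in [set` DS]) (X i @^-1` B J i).
  move=> /fintype.subsetP JD; apply/seteqP; split => w /=.
    move=> <- i /= iD; rewrite /B inE; move: iD; rewrite /DS inE => -> /=.
    by case: ltP => h /=; rewrite in_itv /= ?h // ltNge h.
  move=> h; apply/setP => i; rewrite inE.
  have [iD|/negbTE iD] /= := boolP (i \in D); last first.
    by apply/esym/negbTE/negP => /JD; rewrite inE iD.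
  have := h i; rewrite /= inE => /(_ iD); rewrite /B.
  by case: ifP => _ /=; rewrite in_itv //= => /negP/negbTE.
have EJ0 (J : {set I}) : ~~ (J \subset DS) -> [set w | E w = J] = set0.
  move=> JD; apply/seteqP; split => w //= EwJ; move/negP: JD; apply.
  by rewrite -EwJ; apply/fintype.subsetP => i; rewrite !inE => /andP[].
have mE J : measurable [set w | E w = J].
  have [JD|JD] := boolP (J \subset DS); last by rewrite EJ0.
  rewrite EJ //; apply: fin_bigcap_measurable => [|i _]; last exact: mXB.
  exact: finite_finset.
have PE J : P [set w | E w = J] =
    (rset_wt (fun i => if i \in D then p else 0) J)%:E.
  have [JD|JD] := boolP (J \subset DS); last first.
    rewrite EJ0 // measure0; congr EFin.
    have /fintype.subsetPn [i iJ iD] := JD.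
    rewrite /rset_wt (bigD1 i) //= iJ; move: iD; rewrite inE => /negbTE ->.
    by rewrite mul0r.
  rewrite EJ // indep => [|i|i _]; [|by rewrite inE|exact: mB].
  transitivity (\prod_(i in DS) (if i \in J then p else 1 - p)%:E)%E.
    by apply: eq_bigr => i; rewrite inE => iD; rewrite PXB.
  rewrite prodEFin; congr EFin; rewrite /rset_wt big_mkcond.
  apply: eq_bigr => i _; rewrite inE; case: ifP => // iD.
  case: ifP => [/(fintype.subsetP JD)|_]; first by rewrite inE iD.
  by rewrite subr0.
have -> : [set w | Q (E w)] = \bigcup_(J in [set` Q]) [set w | E w = J].
  by apply/seteqP; split => w /=; [exists (E w) | case=> J QJ /= ->].
split.
  by apply: fin_bigcup_measurable => [|J _]; [exact: finite_finset|exact: mE].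
rewrite measure_fin_bigcup; first last.
- by move=> J _; exact: mE.
- by move=> J J' _ _ [w [/= -> ->]].
- exact: finite_finset.
rewrite -(bigfs _ (index_enum_uniq _)); last first.
  by move=> J _; rewrite mem_index_enum.
rewrite /rset_pr -sumEFin; apply: eq_bigr => J _; exact: PE.
Qed.

(** * Delocalization of subinvariant vectors *)

Definition edge_count (R : realType) (n : nat) (A : 'M[R]_n)
    (S T : {set 'I_n}) : R := \sum_(i in S) \sum_(j in T) A i j.

(** Layer-cake decomposition along the geometric levels M (1 - eta)^c: climbing
    from level c+1 to level c costs eta M (1 - eta)^c, and [x] pays for the climb
    only if it lies above level c+1. *)
Lemma layer_cake_le (R : realType) (eta M x : R) (m : nat) :
  0 <= eta -> 0 <= M -> eta <= 1 -> x <= M ->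
  x <= M * (1 - eta) ^+ m +
       \sum_(c < m) eta * M * (1 - eta) ^+ c * (M * (1 - eta) ^+ c.+1 <= x)%R%:R.
Proof.
move=> eta0 M0 eta1 xM; elim: m => [|m IH].
  by rewrite big_ord0 addr0 expr0 mulr1.
rewrite big_ord_recr /=; case: (leP (M * (1 - eta) ^+ m.+1) x) => [_|xlt].
  apply: (le_trans IH); rewrite mulr1 exprS; lra.
rewrite mulr0 addr0; apply: (le_trans (ltW xlt)); rewrite lerDl.
apply: sumr_ge0 => c _; rewrite !mulr_ge0 ?exprn_ge0 //; lra.
Qed.

(** The last term dominates because y is much smaller than q: this is how the
    high levels, whose level sets are small, contribute only a constant factor. *)
Lemma geometric_mix_le (R : realType) (q y : R) (a : nat) :
  7 / 8 <= q -> 0 <= y <= 1 / 8 ->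
  \sum_(c < a) q ^+ c * y ^+ (a - c.+1) <= 4 / 3 * q ^+ a.
Proof.
move=> q78 /andP[y0 y8]; elim: a => [|a IH].
  by rewrite big_ord0 expr0; lra.
rewrite big_ord_recr /= subnn expr0 mulr1.
have -> : \sum_(i < a) q ^+ i * y ^+ (a.+1 - i.+1) =
          y * \sum_(c < a) q ^+ c * y ^+ (a - c.+1).
  rewrite mulr_sumr; apply: eq_bigr => i _.
  by rewrite subSn // exprS mulrCA.
have qa : 0 <= q ^+ a by rewrite exprn_ge0 //; lra.
have h := ler_wpM2l y0 IH.
have h2 : y * (4 / 3 * q ^+ a) <= 1 / 8 * (4 / 3 * q ^+ a).
  by rewrite ler_wpM2r // mulr_ge0 //; lra.
have h3 : 7 / 8 * q ^+ a <= q ^+ a.+1 by rewrite exprS ler_wpM2r.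
lra.
Qed.

(** Sum the subinvariance over S_a and insert the layer-cake bound for the values
    of [u] at the neighbours: the degrees account for q (1 + del) mu of the left
    side (1 - del) mu, which leaves a deficit of order del mu |S_a| M q^a.  It must
    be paid by the edges from S_a to S_(a+1) and to the higher levels.  As the higher
    level sets are geometrically smaller than S_a and S_(a+1) is at most rho^2
    times larger, the square-root part of the edge bound pays less than half of
    the deficit; the density part must pay the rest, which forces S_(a+1) to be a
    positive proportion of all vertices. *)
Lemma level_set_step (R : realType) (n a : nat) (A : 'M[R]_n)
    (u : 'I_n -> R) (mu del rho M : R) :
  let q := 1 - 4 * del in
  let S c := [set i | M * q ^+ c <= u i]%SET in
  let N c : R := #|S c|%:R in
  0 < mu -> 0 < del <= 1 / 32 -> 8 <= rho -> (15 <= n)%N -> 0 < M ->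
  (forall i j, 0 <= A i j) ->
  (forall i, \sum_j A i j <= (1 + del) * mu) ->
  (forall i, (1 - del) * mu * u i <= \sum_j A i j * u j) ->
  (forall i, u i <= M) ->
  (forall S T : {set 'I_n}, edge_count A S T <=
     3 * mu / (n%:R - 1) * (#|S|%:R * #|T|%:R) +
     mu / (5 * rho) * Num.sqrt (#|S|%:R * #|T|%:R)) ->
  0 < N a ->
  (forall c, (c <= a)%N -> N c <= N a * (rho ^- 2) ^+ (a - c)) ->
  N a.+1 <= rho ^+ 2 * N a ->
  n%:R <= 30 * N a.+1.
Proof.
move=> q S N mu0 /andP[del0 del32] rho8 n15 M0 A0 degA subinv uM disc.
move=> Na0 Nc Na1.
have n1 : (14 : R) <= n%:R - 1.
  by rewrite lerBrDr (_ : 14 + 1 = 15%:R) ?ler_nat //; lra.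
have q78 : 7 / 8 <= q by rewrite /q; lra.
have rho0 : 0 < rho by lra.
have q0 : 0 <= q by lra.
have Nle c : (c <= a)%N -> N c <= N a.+1.
  move=> ca; rewrite ler_nat subset_leq_card //; apply/fintype.subsetP => i.
  rewrite !inE; apply: le_trans; rewrite ler_wpM2l ?(ltW M0) //.
  by rewrite ler_wiXn2l //; [rewrite /q; lra | exact: leqW].
have N0 c : 0 <= N c by rewrite /N ler0n.
set x := N a.+1 / (n%:R - 1).
have x0 : 0 <= x by rewrite divr_ge0 //; lra.
have sqrt_le y z : 0 <= z -> y <= N a * z ^+ 2 ->
    Num.sqrt (N a * y) <= N a * z.
  move=> z0 yz; rewrite -[leRHS]ger0_norm ?mulr_ge0 //.
  rewrite -sqrtr_sqr ler_wsqrtr // exprMn [N a ^+ 2]expr2 -mulrA.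
  by rewrite ler_wpM2l.
have y01 : 0 <= rho^-1 <= 1 / 8.
  by rewrite invr_ge0 (ltW rho0) /= div1r lef_pV2 ?posrE //; lra.
(* The step to S (a+1) loses the factor rho in the square root, which the
   denominator 5 rho compensates. *)
have e_next : edge_count A (S a) (S a.+1) <= mu * N a * (3 * x + 1 / 5).
  apply: (le_trans (disc _ _)); rewrite -/(N a) -/(N a.+1).
  have h : Num.sqrt (N a * N a.+1) <= N a * rho.
    by apply: sqrt_le; [exact: ltW | rewrite mulrC].
  have h2 : mu / (5 * rho) * Num.sqrt (N a * N a.+1)
      <= mu / (5 * rho) * (N a * rho).
    by rewrite ler_wpM2l // divr_ge0 ?mulr_ge0 ?ltW //; lra.
  have -> : mu * N a * (3 * x + 1 / 5) =
    3 * mu / (n%:R - 1) * (N a * N a.+1) + mu / (5 * rho) * (N a * rho).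
    rewrite /x; field; apply/andP; split; lra.
  by rewrite lerD2l.
(* Towards the higher levels, everything decays geometrically. *)
have e_prev c : (c < a)%N -> edge_count A (S a) (S c.+1) <=
    mu * N a * (3 * x + 1 / 40) * rho^-1 ^+ (a - c.+1).
  move=> ca; set l := (a - c.+1)%N.
  have yl0 : 0 <= rho^-1 ^+ l by rewrite exprn_ge0 //; case/andP: y01.
  have Ncl : N c.+1 <= N a * (rho^-1 ^+ l) ^+ 2.
    by have := Nc _ ca; rewrite -/l -!exprVn -!exprM mulnC.
  have yl1 : rho^-1 ^+ l <= 1 by rewrite exprn_ile1 //; lra.
  have Ncl' : N c.+1 <= N a.+1 * rho^-1 ^+ l.
    apply: (le_trans Ncl); rewrite expr2 mulrA ler_wpM2r //.
    apply: (@le_trans _ _ (N a)); last exact: Nle.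
    by rewrite ler_piMr.
  apply: (le_trans (disc _ _)); rewrite -/(N a) -/(N c.+1).
  have h := sqrt_le _ _ yl0 Ncl.
  have h2 : mu / (5 * rho) * Num.sqrt (N a * N c.+1)
      <= mu * (1 / 40) * (N a * rho^-1 ^+ l).
    apply: ler_pM; rewrite ?sqrtr_ge0 //.
      by rewrite divr_ge0 ?mulr_ge0 ?ltW //; lra.
    rewrite ler_wpM2l ?(ltW mu0) // div1r lef_pV2 ?posrE; lra.
  have h3 : 3 * mu / (n%:R - 1) * (N a * N c.+1) <=
      3 * mu / (n%:R - 1) * (N a * (N a.+1 * rho^-1 ^+ l)).
    rewrite ler_wpM2l // ?ler_wpM2l //.
    by rewrite divr_ge0 ?mulr_ge0 ?(ltW mu0) //; lra.
  apply: (le_trans (lerD h3 h2)); rewrite le_eqVlt; apply/orP; left.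
  by apply/eqP; rewrite /x; field; lra.
have sumS : (1 - del) * mu * (M * q ^+ a) * N a <=
    M * q ^+ a.+1 * ((1 + del) * mu) * N a +
    \sum_(c < a.+1) 4 * del * M * q ^+ c * edge_count A (S a) (S c.+1).
  have -> : (1 - del) * mu * (M * q ^+ a) * N a =
      \sum_(i in S a) (1 - del) * mu * (M * q ^+ a).
    by rewrite sumr_const mulr_natr.
  have -> : M * q ^+ a.+1 * ((1 + del) * mu) * N a =
      \sum_(i in S a) M * q ^+ a.+1 * ((1 + del) * mu).
    by rewrite sumr_const mulr_natr.
  under [X in _ <= _ + X]eq_bigr do rewrite mulr_sumr.
  rewrite exchange_big -big_split /=; apply: ler_sum => i.
  rewrite inE => iSa.
  apply: (@le_trans _ _ ((1 - del) * mu * u i)).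
    by rewrite ler_wpM2l // mulr_ge0 ?ltW //; lra.
  apply: (le_trans (subinv i)).
  apply: (@le_trans _ _ (\sum_j A i j * (M * q ^+ a.+1 +
      \sum_(c < a.+1) 4 * del * M * q ^+ c * (j \in S c.+1)%:R))).
    apply: ler_sum => j _; rewrite ler_wpM2l //.
    have := @layer_cake_le _ (4 * del) M (u j) a.+1.
    rewrite -/q => /(_ _ _ _ (uM j)) H.
    apply: le_trans (H _ _ _) _; [lra | exact: ltW | lra |].
    by rewrite lerD2l; apply: ler_sum => c _; rewrite inE.
  under [X in X <= _]eq_bigr do rewrite mulrDr mulr_sumr.
  rewrite big_split /=; apply: lerD.
    rewrite -mulr_suml mulrC ler_wpM2l // mulr_ge0 ?exprn_ge0 //.
    exact: ltW.
  rewrite exchange_big /=; apply: ler_sum => c _.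
  rewrite mulr_sumr [leRHS]big_mkcond /=; apply: ler_sum => j _.
  by case: ifP => _; rewrite ?mulr1 ?mulr0 // mulrC.
have Mq0 : 0 < M * q ^+ a * (mu * N a).
  by rewrite !mulr_gt0 ?exprn_gt0 //; lra.
have bound : \sum_(c < a.+1) 4 * del * M * q ^+ c * edge_count A (S a) (S c.+1)
    <= 4 * del * (7 * x + 1 / 5 + 1 / 30) * (M * q ^+ a * (mu * N a)).
  rewrite big_ord_recr /=.
  have dM0 c : 0 <= 4 * del * M * q ^+ c.
    by rewrite !mulr_ge0 ?exprn_ge0 ?(ltW M0) //; lra.
  have b1 := ler_wpM2l (dM0 a) e_next.
  have b2 : \sum_(c < a) 4 * del * M * q ^+ c * edge_count A (S a) (S c.+1) <=
      4 * del * M * (mu * N a * (3 * x + 1 / 40)) * (4 / 3 * q ^+ a).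
    apply: (@le_trans _ _ (4 * del * M * (mu * N a * (3 * x + 1 / 40)) *
       \sum_(c < a) q ^+ c * rho^-1 ^+ (a - c.+1))).
      rewrite mulr_sumr; apply: ler_sum => c _.
      apply: le_trans (ler_wpM2l (dM0 c) (e_prev _ (ltn_ord c))) _.
      by rewrite le_eqVlt; apply/orP; left; apply/eqP; ring.
    have x40 : 0 <= 3 * x + 1 / 40 by lra.
    rewrite ler_wpM2l ?geometric_mix_le //.
    by rewrite !mulr_ge0 ?x40 ?N0 ?(ltW M0) ?(ltW mu0) ?(ltW del0).
  apply: (le_trans (lerD b2 b1)).
  by rewrite le_eqVlt; apply/orP; left; apply/eqP; field.
have key : (1 - del) * (M * q ^+ a * (mu * N a)) <=
   (q * (1 + del) + 4 * del * (7 * x + 1 / 5 + 1 / 30)) *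
     (M * q ^+ a * (mu * N a)).
  apply: (@le_trans _ _ ((1 - del) * mu * (M * q ^+ a) * N a)).
    by rewrite le_eqVlt; apply/orP; left; apply/eqP; ring.
  apply: (le_trans sumS); rewrite [leRHS]mulrDl; apply: lerD => //.
  by rewrite exprS le_eqVlt; apply/orP; left; apply/eqP; ring.
rewrite ler_pM2r // in key.
have x38 : 8 / 210 <= x.
  have : 4 * del * (1 / 2) <= 4 * del * (7 * x + 1 / 5 + 1 / 30).
    have := sqr_ge0 del; rewrite /q in key; lra.
  by rewrite ler_pM2l; lra.
have : 8 / 210 * (n%:R - 1) <= N a.+1 by rewrite -ler_pdivlMr //; lra.
lra.
Qed.

(** Choose the level a <= k for which |S_a| rho^(-2a) is maximal.  If a = k then S_k
    contains at least rho^(2k) >= n vertices; otherwise maximality gives exactly the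
    growth hypotheses of [level_set_step].  Either way |S_k| >= n/30, and on S_k the
    vector is at least half its maximum. *)
Lemma subinvariant_delocalized (R : realType) (n k : nat) (A : 'M[R]_n)
    (u : 'I_n -> R) (mu del rho : R) :
  0 < mu -> 0 < del <= 1 / 32 -> 8 <= rho -> (15 <= n)%N ->
  (forall i j, 0 <= A i j) ->
  (forall i, \sum_j A i j <= (1 + del) * mu) ->
  (forall i, 0 <= u i) ->
  (forall i, (1 - del) * mu * u i <= \sum_j A i j * u j) ->
  (forall S T : {set 'I_n}, edge_count A S T <=
     3 * mu / (n%:R - 1) * (#|S|%:R * #|T|%:R) +
     mu / (5 * rho) * Num.sqrt (#|S|%:R * #|T|%:R)) ->
  n%:R <= (rho ^+ 2) ^+ k -> 4 * del * k%:R <= 1 / 2 ->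
  forall i, u i ^+ 2 <= 120 / n%:R * \sum_j u j ^+ 2.
Proof.
move=> mu0 del0 rho8 n15 A0 degA u0 subinv disc nk dk i.
have i0 : 'I_n by exact: i.
have [j0 _ ujmax] := @arg_maxP _ _ _ i0 xpredT u isT.
set M := u j0 in ujmax.
have uM j : u j <= M by exact: ujmax.
have n0 : (0 : R) < n%:R by rewrite ltr0n (leq_trans _ n15).
have [M0|M0] := leP M 0.
  have -> : u i = 0 by apply/eqP; rewrite eq_le u0 (le_trans (uM i)).
  rewrite expr2 mulr0; apply: mulr_ge0; first by rewrite divr_ge0 ?ler0n.
  by apply: sumr_ge0 => j _; exact: sqr_ge0.
pose q := 1 - 4 * del.
pose S c := [set j | M * q ^+ c <= u j]%SET.
pose N c : R := #|S c|%:R.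
have rho0 : 0 < rho by lra.
have r0 : 0 < rho ^- 2 by rewrite invr_gt0 exprn_gt0.
have q01 : 0 <= q <= 1 by rewrite /q; lra.
have Nmono c c' : (c <= c')%N -> N c <= N c'.
  move=> cc; rewrite ler_nat subset_leq_card //; apply/fintype.subsetP => j.
  rewrite !inE; apply: le_trans; rewrite ler_wpM2l ?(ltW M0) //.
  by rewrite ler_wiXn2l //; case/andP: q01.
have N0 : 1 <= N 0%N.
  rewrite ler1n card_gt0; apply/set0Pn; exists j0.
  by rewrite inE expr0 mulr1.
have Nk : n%:R <= 30 * N k.
  pose f (c : 'I_k.+1) := N c * (rho ^- 2) ^+ c.
  have [a _ fmax] := @arg_maxP _ _ _ (ord0 : 'I_k.+1) xpredT f isT.
  have Nc (c : nat) : (c <= k)%N ->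
      N c * (rho ^- 2) ^+ c <= N a * (rho ^- 2) ^+ a.
    by move=> ck; have := fmax (Ordinal (ck : (c < k.+1)%N)) isT.
  have Na1 : 1 <= N a * (rho ^- 2) ^+ a.
    by apply: le_trans (Nc 0%N _); rewrite ?expr0 ?mulr1.
  have [ak|ak] := ltnP a k; last first.
    have aE : nat_of_ord a = k by apply/eqP; rewrite eqn_leq ak -ltnS ltn_ord.
    have : (rho ^+ 2) ^+ a <= N a.
      by move: Na1; rewrite exprVn ler_pdivlMr ?exprn_gt0 // mul1r.
    rewrite aE.
    have : 0 <= N k by rewrite /N ler0n.
    by lra.
  apply: (@le_trans _ _ (30 * N a.+1)); last first.
    by rewrite ler_wpM2l // Nmono.
  apply: (@level_set_step _ _ _ A u mu del rho M) => //.
  - have : 0 < N a * (rho ^- 2) ^+ a by lra.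
    by rewrite pmulr_lgt0 // exprn_gt0.
  - move=> c ca; have := Nc c (leq_trans ca (ltnW ak)).
    by rewrite -{2}(subnK ca) exprD mulrA ler_pM2r // exprn_gt0.
  - have := Nc a.+1 ak.
    rewrite exprS mulrA ler_pM2r ?exprn_gt0 // ler_pdivrMr ?exprn_gt0 //.
    by rewrite mulrC.
(* Bernoulli's inequality. *)
have qk : 1 / 2 <= q ^+ k.
  have : 1 + - (4 * del) *+ k <= (1 - 4 * del) ^+ k.
    elim: (k) => [|m IH]; first by rewrite mulr0n addr0 expr0.
    rewrite exprS mulrS.
    have qge0 : 0 <= 1 - 4 * del by case/andP: q01.
    apply: le_trans (ler_wpM2l qge0 IH).
    rewrite -[_ *+ m]mulr_natr -subr_ge0.
    have -> : (1 - 4 * del) * (1 + - (4 * del) * m%:R) -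
      (1 + (- (4 * del) + - (4 * del) * m%:R)) = 16 * del ^+ 2 * m%:R by ring.
    by apply: mulr_ge0; rewrite ?ler0n //; apply: mulr_ge0; rewrite ?sqr_ge0.
  rewrite -[_ *+ k]mulr_natr -/q; lra.
have qk2 : 1 / 4 <= (q ^+ k) ^+ 2.
  have -> : (1 / 4 : R) = (1 / 2) ^+ 2 by field.
  by rewrite lerXn2r ?nnegrE; lra.
have sumu : N k * (M ^+ 2 / 4) <= \sum_j u j ^+ 2.
  apply: (@le_trans _ _ (\sum_(j in S k) u j ^+ 2)).
    rewrite mulrC mulr_natr -sumr_const; apply: ler_sum => j.
    rewrite inE => jS; apply: (@le_trans _ _ ((M * q ^+ k) ^+ 2)).
      by rewrite exprMn ler_wpM2l ?sqr_ge0 // -div1r.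
    have qk0 : 0 <= q ^+ k by lra.
    by rewrite lerXn2r ?nnegrE ?mulr_ge0 ?(ltW M0).
  rewrite big_mkcond; apply: ler_sum => j _; case: ifP => // _.
  exact: sqr_ge0.
have h : u i ^+ 2 <= M ^+ 2 by rewrite lerXn2r ?nnegrE ?(ltW M0).
apply: (le_trans h); rewrite mulrAC ler_pdivlMr //.
have := ler_wpM2l (sqr_ge0 M) Nk; lra.
Qed.

(** * The largest eigenvalue bounds the Rayleigh quotient *)

Lemma psd_Cauchy_Schwarz (R : realType) (n : nat) (B : 'M[R]_n)
    (x y : 'cV[R]_n) :
  B^T = B -> (forall z : 'cV[R]_n, 0 <= (z^T *m B *m z) 0 0) ->
  (x^T *m B *m y) 0 0 ^+ 2 <= (x^T *m B *m x) 0 0 * (y^T *m B *m y) 0 0.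
Proof.
move=> Bsym psd.
set a := (x^T *m B *m x) 0 0; set b := (x^T *m B *m y) 0 0.
set c := (y^T *m B *m y) 0 0.
have yx : (y^T *m B *m x) 0 0 = b.
  by rewrite /b -[RHS]trace_mx11 -mxtrace_tr trace_mx11 !trmx_mul trmxK Bsym mulmxA.
have form s t : 0 <= s ^+ 2 * a + 2 * s * t * b + t ^+ 2 * c.
  have addE (M N : 'M[R]_1) : (M + N) 0 0 = M 0 0 + N 0 0 by rewrite mxE.
  have scaleE r (M : 'M[R]_1) : (r *: M) 0 0 = r * M 0 0 by rewrite mxE.
  have := psd (s *: x + t *: y).
  have -> : (s *: x + t *: y)^T = s *: x^T + t *: y^T by rewrite linearD !linearZ.
  rewrite !mulmxDl !mulmxDr -!scalemxAl -!scalemxAr.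
  rewrite !addE !scaleE yx -/a -/b -/c.
  by congr (_ <= _); ring.
have a0 : 0 <= a by exact: psd.
have c0 : 0 <= c by exact: psd.
(* c x - b y minimizes the form for a fixed coefficient of x, and a y - b x for a
   fixed coefficient of y; adding the two covers a = 0 and c = 0 alike. *)
have h1 := form c (- b); have h2 := form (- b) a.
have [ac|ac] := leP (a + c) 0.
  have a00 : a = 0 by lra.
  have c00 : c = 0 by lra.
  have := form b (-1); rewrite a00 c00; nra.
have : 0 <= (a + c) * (a * c - b ^+ 2) by nra.
by rewrite pmulr_rge0 // subr_ge0.
Qed.

Lemma mx_form_le (R : realType) (n : nat) (B : 'M[R]_n) (x : 'cV[R]_n) :
  `|(x^T *m B *m x) 0 0| <= (\sum_i \sum_j `|B i j|) * \sum_i x i 0 ^+ 2.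
Proof.
have xle i : x i 0 ^+ 2 <= \sum_i x i 0 ^+ 2.
  by rewrite (bigD1 i) //= lerDl sumr_ge0 // => j _; exact: sqr_ge0.
rewrite -mulmxA mxE mulr_suml.
apply: le_trans (ler_norm_sum _ _ _) _; apply: ler_sum => i _.
rewrite [x^T _ _]mxE [(B *m x) _ _]mxE [X in `|X| <= _]mulr_sumr mulr_suml.
apply: le_trans (ler_norm_sum _ _ _) _; apply: ler_sum => j _.
rewrite !normrM mulrCA ler_wpM2l //.
have := xle i; have := xle j.
rewrite -(real_normK (num_real (x i 0))) -(real_normK (num_real (x j 0))).
have := sqr_ge0 (`|x i 0| - `|x j 0|).
nra.
Qed.

(** Let m be the least number for which m - A is positive semidefinite.  If m were
    not an eigenvalue, B = m - A would be invertible, and the Cauchy-Schwarz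
    inequality for the form of B, applied to z and B^-1 z, would give
    |z|^4 <= (z^T B z) (C |z|^2), so m could be lowered by 1/C.  Hence m is an
    eigenvalue, and it bounds the Rayleigh quotient. *)
Lemma rayleigh_le_largest_eigenvalue (R : realType) (n : nat) (A : 'M[R]_n)
    (l : R) (x : 'cV[R]_n) :
  (0 < n)%N -> A^T = A -> (forall m, eigenvalue A m -> m <= l) ->
  (x^T *m A *m x) 0 0 <= l * \sum_i x i 0 ^+ 2.
Proof.
move=> n0 Asym lmax.
pose sq (z : 'cV[R]_n) := \sum_i z i 0 ^+ 2.
have sq0 z : 0 <= sq z by apply: sumr_ge0 => i _; exact: sqr_ge0.
have sqE z : (z^T *m z) 0 0 = sq z.
  by rewrite mxE; apply: eq_bigr => i _; rewrite mxE -expr2.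
pose Z := [set m : R | forall z : 'cV[R]_n, (z^T *m A *m z) 0 0 <= m * sq z].
have Z0 : Z !=set0.
  exists (\sum_i \sum_j `|A i j|) => z.
  exact: le_trans (ler_norm _) (mx_form_le _ _).
have Zlb : has_lbound Z.
  pose e : 'cV[R]_n := delta_mx (Ordinal n0) 0.
  have sqe : sq e = 1.
    rewrite /sq (bigD1 (Ordinal n0)) //= big1 ?addr0 => [|i /negPf ni].
      by rewrite mxE !eqxx expr1n.
    by rewrite mxE ni expr0n.
  by exists ((e^T *m A *m e) 0 0) => m /(_ e); rewrite sqe mulr1.
pose m := inf Z.
have mZ : Z m.
  move=> z; have [zz|zz] := leP (sq z) 0.
    have z00 : sq z = 0 by apply/eqP; rewrite eq_le zz sq0.
    have := mx_form_le A z; rewrite -/(sq z) z00 !mulr0 normr_le0.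
    by move=> /eqP ->.
  rewrite -ler_pdivrMr //; apply: lb_le_inf => // m' /(_ z).
  by rewrite ler_pdivrMr.
suff ml : m <= l by apply: le_trans (mZ x) _; rewrite ler_wpM2r // sq0.
apply: lmax; apply: contrapT => notev.
pose B : 'M[R]_n := m%:M - A.
have formB z : (z^T *m B *m z) 0 0 = m * sq z - (z^T *m A *m z) 0 0.
  rewrite /B mulmxBr mulmxBl mul_mx_scalar -scalemxAl -sqE.
  by rewrite [LHS]mxE [X in X + _]mxE [X in _ + X]mxE.
have Bsym : B^T = B by rewrite /B linearB /= tr_scalar_mx Asym.
have Bpsd (z : 'cV[R]_n) : 0 <= (z^T *m B *m z) 0 0 by rewrite formB subr_ge0; exact: mZ.
have Bunit : B \in unitmx.
  rewrite unitmxE unitfE; apply/negP => /det0P [v v0 vB].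
  apply: notev; apply/eigenvalueP; exists v => //.
  by apply/eqP; rewrite eq_sym -subr_eq0 -mul_mx_scalar -mulmxBr vB.
pose C := 1 + \sum_i \sum_j `|invmx B i j|.
have C0 : 0 < C.
  by rewrite ltr_wpDr // sumr_ge0 // => i _; rewrite sumr_ge0.
have : Z (m - C^-1).
  move=> z; rewrite mulrBl lerBrDr addrC -lerBrDr -formB.
  have [zz|zz] := leP (sq z) 0.
    apply: le_trans (Bpsd z); rewrite mulr_ge0_le0 // invr_ge0; exact: ltW.
  pose y := invmx B *m z.
  have By : B *m y = z by rewrite mulmxA mulmxV ?mul1mx.
  have h1 : (z^T *m B *m y) 0 0 = sq z by rewrite -mulmxA By sqE.
  have h2 : (y^T *m B *m y) 0 0 <= C * sq z.
    rewrite -mulmxA By /y trmx_mul trmx_inv Bsym.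
    apply: le_trans (ler_norm _) (le_trans (mx_form_le _ _) _).
    rewrite ler_wpM2r //; first exact: sq0.
    by rewrite /C lerDr.
  have := psd_Cauchy_Schwarz z y Bsym Bpsd; rewrite h1 => h3.
  have h4 : sq z ^+ 2 <= (z^T *m B *m z) 0 0 * (C * sq z).
    by apply: (le_trans h3); rewrite ler_wpM2l.
  rewrite expr2 mulrA ler_pM2r // in h4.
  by rewrite mulrC ler_pdivrMr.
move=> /(ge_inf Zlb); rewrite -/m lerBrDr gerDl => h.
by rewrite invr_le0 leNgt C0 in h.
Qed.

(** * Graphs as sets of pairs *)

(** The representative of the unordered pair {i, j} among the upper pairs. *)
Definition edge (n : nat) (i j : 'I_n) : 'I_n * 'I_n :=
  if (i < j)%N then (i, j) else (j, i).

Definition graph_mx (R : realType) (n : nat) (J : {set 'I_n * 'I_n}) : 'M[R]_n :=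
  \matrix_(i, j) ((i != j) && (edge i j \in J))%:R.

(** Pairs outside the upper triangle get probability 0, so that the random set of
    all pairs is a random graph. *)
Definition edge_pr (R : realType) (n : nat) (p : R) (ij : 'I_n * 'I_n) : R :=
  if ij \in @upper_pairs n then p else 0.

Lemma edge_pr01 (R : realType) (n : nat) (p : R) (ij : 'I_n * 'I_n) :
  0 <= p <= 1 -> 0 <= edge_pr p ij <= 1.
Proof. by move=> p01; rewrite /edge_pr; case: ifP => // _; rewrite lexx ler01. Qed.

Lemma edge_upper (n : nat) (i j : 'I_n) :
  i != j -> edge i j \in @upper_pairs n.
Proof.
move=> ij; rewrite /edge; case: ltnP => [//|ji].
by rewrite inE /= ltn_neqAle ji andbT eq_sym.
Qed.

Lemma edgeC (n : nat) (i j : 'I_n) : edge i j = edge j i.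
Proof. by rewrite /edge; case: ltngtP => // /val_inj ->. Qed.

Lemma edge_inj (n : nat) (i : 'I_n) : injective (edge i).
Proof. by move=> j j'; rewrite /edge; case: ifP => _; case: ifP => _; congruence. Qed.

Lemma edge_fiber (n : nat) (i j : 'I_n) (e : 'I_n * 'I_n) :
  edge i j = e -> (i, j) \in [set e; (e.2, e.1)]%SET.
Proof. by rewrite /edge !inE => <-; case: ifP; rewrite eqxx ?orbT. Qed.

Lemma graph_mx_ge0 (R : realType) (n : nat) (J : {set 'I_n * 'I_n}) i j :
  0 <= graph_mx R J i j.
Proof. by rewrite mxE ler0n. Qed.

Lemma graph_mx_sym (R : realType) (n : nat) (J : {set 'I_n * 'I_n}) i j :
  graph_mx R J i j = graph_mx R J j i.
Proof. by rewrite !mxE edgeC eq_sym. Qed.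

Definition star (n : nat) (i : 'I_n) : {set 'I_n * 'I_n} :=
  [set edge i j | j in [set~ i]]%SET.

Lemma degree_card (R : realType) (n : nat) (J : {set 'I_n * 'I_n}) (i : 'I_n) :
  \sum_j graph_mx R J i j = #|J :&: star i|%:R.
Proof.
rewrite -sumr_const /=.
rewrite (eq_bigl (fun e => (e \in star i) && (e \in J))); last first.
  by move=> e; rewrite inE andbC.
rewrite big_mkcondr big_imset /=; last by move=> j j' _ _; exact: edge_inj.
rewrite [RHS]big_mkcond; apply: eq_bigr => j _.
rewrite mxE !inE eq_sym; case: (j != i) => //=.
by case: ifP.
Qed.

Lemma edge_pr_sum (R : realType) (n : nat) (p : R) (F : {set 'I_n * 'I_n}) :
  {subset F <= @upper_pairs n} ->
  \sum_(e in F) edge_pr p e = #|F|%:R * p.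
Proof.
move=> Fup; rewrite mulrC mulr_natr -sumr_const.
by apply: eq_bigr => e /Fup; rewrite /edge_pr => ->.
Qed.

Lemma star_mean (R : realType) (n : nat) (p : R) (i : 'I_n) :
  \sum_(e in star i) edge_pr p e = (n%:R - 1) * p.
Proof.
have n0 : (0 < n)%N by exact: leq_ltn_trans (ltn_ord i).
rewrite edge_pr_sum => [|e /imsetP [j]]; last first.
  by rewrite !inE => ji ->; apply: edge_upper; rewrite eq_sym.
rewrite card_imset; last exact: edge_inj.
by rewrite cardsC1 card_ord -subn1 natrB.
Qed.

Lemma degree_upper_tail (R : realType) (n : nat) (p del : R) (i : 'I_n) :
  0 <= p <= 1 -> 0 <= del <= 2 / 3 ->
  let mu := (n%:R - 1) * p in
  rset_pr (edge_pr p) (fun J => (1 + del) * mu < \sum_j graph_mx R J i j)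
    <= expR (- (del ^+ 2 / 4 * mu)).
Proof.
move=> p01 /andP[d0 d1] /=; set mu := _ * p.
have -> : - (del ^+ 2 / 4 * mu) = - (del / 2 * ((1 + del) * mu)) +
    (del / 2 + (del / 2) ^+ 2) * \sum_(e in star i) edge_pr p e.
  by rewrite star_mean -/mu; field.
apply: rset_chernoff => [e||J]; [exact: edge_pr01|lra|].
by rewrite degree_card => /ltW h; rewrite ler_wpM2l //; lra.
Qed.

Lemma degree_lower_tail (R : realType) (n : nat) (p del : R) (i : 'I_n) :
  0 <= p <= 1 -> 0 <= del ->
  let mu := (n%:R - 1) * p in
  rset_pr (edge_pr p) (fun J => \sum_j graph_mx R J i j < (1 - del) * mu)
    <= expR (- (del ^+ 2 / 4 * mu)).
Proof.
move=> p01 d0 /=; set mu := _ * p.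
have -> : - (del ^+ 2 / 4 * mu) = - (- (del / 2) * ((1 - del) * mu)) +
    (- (del / 2) + (- (del / 2)) ^+ 2) * \sum_(e in star i) edge_pr p e.
  by rewrite star_mean -/mu; field.
apply: rset_chernoff => [e||J]; [exact: edge_pr01|lra|].
by rewrite degree_card => /ltW h; rewrite !mulNr lerN2 ler_wpM2l //; lra.
Qed.

Lemma edge_count_le_card (R : realType) (n : nat) (J : {set 'I_n * 'I_n})
    (S T : {set 'I_n}) :
  edge_count (graph_mx R J) S T <= #|S|%:R * #|T|%:R.
Proof.
rewrite /edge_count -natrM -sum_nat_const natr_sum; apply: ler_sum => i _.
rewrite -sum1_card natr_sum; apply: ler_sum => j _.
by rewrite mxE ler_nat leq_b1.
Qed.

Lemma edge_countC (R : realType) (n : nat) (A : 'M[R]_n) (S T : {set 'I_n}) :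
  (forall i j, A i j = A j i) -> edge_count A S T = edge_count A T S.
Proof.
move=> Asym; rewrite /edge_count exchange_big /=.
by apply: eq_bigr => i _; apply: eq_bigr => j _.
Qed.

Lemma edge_count_le_degree (R : realType) (n : nat) (A : 'M[R]_n) (D : R)
    (S T : {set 'I_n}) :
  (forall i j, 0 <= A i j) -> (forall i, \sum_j A i j <= D) ->
  edge_count A S T <= D * #|S|%:R.
Proof.
move=> A0 degA; rewrite mulr_natr -sumr_const; apply: ler_sum => i _.
apply: le_trans (degA i); rewrite big_mkcond; apply: ler_sum => j _.
by case: ifP.
Qed.

Definition pairs_between (n : nat) (S T : {set 'I_n}) : {set 'I_n * 'I_n} :=
  [set edge ij.1 ij.2 | ij in [set ij in finset.setX S T | ij.1 != ij.2]]%SET.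

(** An edge inside S :&: T is counted from both of its ends, hence the factor 2. *)
Lemma edge_count_le_pairs (R : realType) (n : nat) (J : {set 'I_n * 'I_n})
    (S T : {set 'I_n}) :
  edge_count (graph_mx R J) S T <= 2 * #|J :&: pairs_between S T|%:R.
Proof.
pose X := [set ij in finset.setX S T | ij.1 != ij.2]%SET.
pose h (ij : 'I_n * 'I_n) := edge ij.1 ij.2.
have -> : edge_count (graph_mx R J) S T = \sum_(ij in X) (h ij \in J)%:R.
  rewrite /edge_count pair_big /= big_mkcond [RHS]big_mkcond /=.
  apply: eq_bigr => -[i j] _; rewrite !inE mxE /h /=.
  by case: (i \in S) => //=; case: (j \in T) => //=; case: (i != j).
rewrite (partition_big_imset h) /= -/(pairs_between S T).
rewrite -[#|_|%:R]/(#|_|%:R) -sumr_const.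
rewrite [X in _ <= 2 * X](eq_bigl (fun e => (e \in pairs_between S T) &&
  (e \in J))); last by move=> e; rewrite inE andbC.
rewrite [X in _ <= 2 * X]big_mkcondr mulr_sumr; apply: ler_sum => e _.
case: ifP => eJ; last first.
  by rewrite mulr0 big1 // => ij /andP[_ /eqP ->]; rewrite eJ.
rewrite mulr1 (eq_bigr (fun=> 1)) => [|ij /andP[_ /eqP ->]]; last first.
  by rewrite eJ.
rewrite sumr_const ler_nat.
apply: (@leq_trans #|[set e; (e.2, e.1)]%SET|).
  rewrite subset_leq_card //; apply/fintype.subsetP => -[a b].
  by rewrite unfold_in => /andP[_ /eqP]; exact: edge_fiber.
by rewrite cards2 ltnS leq_b1.
Qed.

Lemma pairs_between_card (n : nat) (S T : {set 'I_n}) :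
  (#|pairs_between S T| <= #|S| * #|T|)%N.
Proof.
apply: leq_trans (leq_imset_card _ _) _; rewrite -cardsX subset_leq_card //.
by apply/fintype.subsetP => ij; rewrite !inE => /andP[].
Qed.

Lemma pairs_between_mean (R : realType) (n : nat) (p : R)  (S T : {set 'I_n}) :
  0 <= p ->
  \sum_(e in pairs_between S T) edge_pr p e <= p * (#|S|%:R * #|T|%:R).
Proof.
move=> p0; rewrite edge_pr_sum => [|e /imsetP [[i j]]]; last first.
  by rewrite !inE /= => /andP[_ ij] ->; exact: edge_upper.
by rewrite mulrC ler_wpM2l // -natrM ler_nat pairs_between_card.
Qed.

(** * Quasirandom graphs and their probability *)

Definition discrepancy_bound (R : realType) (n : nat) (p g : R)
    (S T : {set 'I_n}) : R :=
  let st : R := #|S|%:R * #|T|%:R in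
  3 * p * st + (n%:R - 1) * p / g * Num.sqrt st.

(** Two trivial bounds confine the possible violations: e(S,T) <= |S||T| rules out
    small sets, and e(S,T) <= 2 mu min(|S|,|T|) rules out unbalanced ones. *)
Lemma discrepancy_violation_sizes (R : realType) (n : nat) (p g : R)
    (A : 'M[R]_n) (S T : {set 'I_n}) :
  let mu := (n%:R - 1) * p in
  let st : R := #|S|%:R * #|T|%:R in
  0 <= p -> 0 < mu -> 0 < g ->
  (forall i j, 0 <= A i j) -> (forall i j, A i j = A j i) ->
  (forall i, \sum_j A i j <= 2 * mu) -> edge_count A S T <= st ->
  discrepancy_bound p g S T < edge_count A S T ->
  mu / g <= Num.sqrt st /\ #|S|%:R + #|T|%:R <= 4 * g * Num.sqrt st.
Proof.
move=> mu st p0 mu0 g0 A0 Asym degA e_st.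
have s0 : (0 : R) <= #|S|%:R by rewrite ler0n.
have t0 : (0 : R) <= #|T|%:R by rewrite ler0n.
have st0 : 0 <= st by rewrite mulr_ge0.
rewrite /discrepancy_bound -/st -/mu; set r := Num.sqrt st => viol.
have r0 : 0 <= r by exact: sqrtr_ge0.
have rr : r * r = st by rewrite -expr2 sqr_sqrtr.
have e_gt : mu / g * r < edge_count A S T.
  apply: le_lt_trans viol; rewrite lerDr !mulr_ge0 //; lra.
have r1 : 0 < r.
  rewrite lt_neqAle eq_sym r0 andbT; apply/eqP => r00.
  move: e_gt; rewrite r00 mulr0 => /lt_le_trans /(_ e_st).
  by rewrite -rr r00 mulr0 ltxx.
have eS : edge_count A S T <= 2 * mu * #|S|%:R by exact: edge_count_le_degree.
have eT : edge_count A S T <= 2 * mu * #|T|%:R.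
  by rewrite (edge_countC S T Asym); exact: edge_count_le_degree.
have aux (x : R) : edge_count A S T <= 2 * mu * x -> r < 2 * g * x.
  move=> /(lt_le_trans e_gt); rewrite mulrAC ltr_pdivrMr //.
  have -> : 2 * mu * x * g = mu * (2 * g * x) by ring.
  by rewrite ltr_pM2l.
split.
  by have := lt_le_trans e_gt e_st; rewrite -rr ltr_pM2r // => /ltW.
have := aux _ eS; have := aux _ eT => hT hS.
have T2 : #|T|%:R <= 2 * g * r.
  rewrite -(ler_pM2l r1).
  have -> : r * (2 * g * r) = 2 * g * #|S|%:R * #|T|%:R.
    by rewrite -[RHS]mulrA -/st -[in RHS]rr; ring.
  by rewrite ler_wpM2r // ltW.
have S2 : #|S|%:R <= 2 * g * r.
  rewrite -(ler_pM2l r1).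
  have -> : r * (2 * g * r) = 2 * g * #|T|%:R * #|S|%:R.
    by rewrite -[RHS]mulrA [X in _ = _ * X]mulrC -/st -[in RHS]rr; ring.
  by rewrite ler_wpM2r // ltW.
lra.
Qed.

(** Chernoff's bound with t = 1/3: the term 3 p |S||T| absorbs the mean, and the
    remaining exponent (mu / (6 g)) sqrt(|S||T|) is split into two halves.  By
    [discrepancy_violation_sizes] one half dominates ln n (|S| + |T|) and the other
    4 mu. *)
Lemma discrepancy_tail (R : realType) (n : nat) (p g : R) (S T : {set 'I_n}) :
  let mu := (n%:R - 1) * p in
  0 <= p <= 1 -> 0 < mu -> 0 < g -> 1 <= ln n%:R :> R ->
  48 * g ^+ 2 * ln n%:R <= mu ->
  rset_pr (edge_pr p) (fun J =>
    [forall i, \sum_j graph_mx R J i j <= 2 * mu] &&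
    (discrepancy_bound p g S T < edge_count (graph_mx R J) S T))
  <= expR (- (4 * mu)) *
     (expR (- ln n%:R) ^+ #|S| * expR (- ln n%:R) ^+ #|T|).
Proof.
move=> mu p01 mu0 g0 ln1 hmu; have p0 : 0 <= p by case/andP: p01.
set Q := (fun J => _ && _).
have [[J QJ]|noQ] := pselect (exists J, Q J); last first.
  rewrite /rset_pr big1 => [|J QJ]; last by case: noQ; exists J.
  by rewrite !mulr_ge0 ?exprn_ge0 ?expR_ge0.
case/andP: (QJ) => /forallP degJ viol.
have [] := discrepancy_violation_sizes p0 mu0 g0 (graph_mx_ge0 R J)
  (graph_mx_sym R J) degJ (edge_count_le_card R J S T) viol.
rewrite -/mu; set st : R := #|S|%:R * #|T|%:R; set r := Num.sqrt st => r_ge st_le.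
have g2 : 0 < g ^+ 2 by rewrite exprn_gt0.
have exponent : 4 * mu + ln n%:R * (#|S|%:R + #|T|%:R) <= mu / (6 * g) * r.
  have h1 : 4 * mu <= mu / (12 * g) * r.
    apply: (@le_trans _ _ (mu / (12 * g) * (mu / g))); last first.
      by rewrite ler_wpM2l // divr_ge0; lra.
    have -> : mu / (12 * g) * (mu / g) = mu * (mu / (12 * g ^+ 2)).
      by field; lra.
    rewrite mulrC ler_pM2l // ler_pdivlMr ?mulr_gt0 //.
    apply: le_trans hmu; have := ler_wpM2l (ltW g2) ln1; lra.
  have h2 : ln n%:R * (#|S|%:R + #|T|%:R) <= mu / (12 * g) * r.
    apply: (@le_trans _ _ (ln n%:R * (4 * g * r))).
      by rewrite ler_wpM2l //; lra.
    have -> : ln n%:R * (4 * g * r) =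
       48 * g ^+ 2 * ln n%:R * (r / (12 * g)) by field; lra.
    have -> : mu / (12 * g) * r = mu * (r / (12 * g)) by ring.
    by rewrite ler_wpM2r // divr_ge0 ?sqrtr_ge0 //; lra.
  have -> : mu / (6 * g) * r = mu / (12 * g) * r + mu / (12 * g) * r.
    by field; lra.
  exact: lerD.
apply: (le_trans (rset_chernoff (F := pairs_between S T) (t := 1 / 3)
  (a := 1 / 6 * discrepancy_bound p g S T) _ _ _)).
- by move=> e; exact: edge_pr01.
- by [].
- move=> J' /andP[_ /ltW h].
  have := le_trans h (edge_count_le_pairs R J' S T); lra.
have -> : expR (- (4 * mu)) * (expR (- ln n%:R) ^+ #|S| * expR (- ln n%:R) ^+ #|T|)
  = expR (- (4 * mu + ln n%:R * (#|S|%:R + #|T|%:R))).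
  by rewrite -!expRM_natl -!expRD; congr expR; ring.
rewrite ler_expR /discrepancy_bound -/st -/r -/mu.
have := pairs_between_mean S T p0; rewrite -/st.
have : 0 <= p * st by rewrite mulr_ge0 ?mulr_ge0.
have -> : mu / g * r = 6 * (mu / (6 * g) * r) by field; lra.
move: exponent; lra.
Qed.

Definition quasirandom (R : realType) (n : nat) (p del g : R)
    (J : {set 'I_n * 'I_n}) : bool :=
  [forall i, (1 - del) * ((n%:R - 1) * p) <= \sum_j graph_mx R J i j
               <= (1 + del) * ((n%:R - 1) * p)] &&
  [forall ST : {set 'I_n} * {set 'I_n},
     edge_count (graph_mx R J) ST.1 ST.2 <= discrepancy_bound p g ST.1 ST.2].

Lemma sum_set_pow (R : comNzRingType) (I : finType) (x : R) :
  \sum_(S : {set I}) x ^+ #|S| = (x + 1) ^+ #|I|.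
Proof.
rewrite -prodr_const bigA_distr; apply: eq_bigr => S _.
by rewrite -prodr_const big_mkcond.
Qed.

(** In the union bound over all pairs of sets, the weights n^-|S| n^-|T| sum to
    (1 + 1/n)^(2n) <= e^2, so the edge conditions cost at most exp(2 - 4 mu). *)
Lemma quasirandom_pr (R : realType) (n : nat) (p del g : R) :
  let mu := (n%:R - 1) * p in
  0 <= p <= 1 -> 1 <= mu -> 0 <= del <= 1 / 2 -> 0 < g -> 1 <= ln n%:R :> R ->
  48 * g ^+ 2 * ln n%:R <= mu ->
  rset_pr (edge_pr p) (predC (quasirandom p del g : pred {set 'I_n * 'I_n}))
    <= 2 * n%:R * expR (- (del ^+ 2 / 4 * mu)) + expR (- mu).
Proof.
move=> mu p01 mu1 /andP[d0 d1] g0 ln1 hmu.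
have mu0 : 0 < mu by lra.
have pi01 := fun e => @edge_pr01 R n p e p01.
have n0 : (0 : R) < n%:R.
  by rewrite ltNge; apply/negP => h; have := ln_le0 (le_trans h ler01); lra.
pose Qu (i : 'I_n) (J : {set 'I_n * 'I_n}) :=
  (1 + del) * mu < \sum_j graph_mx R J i j.
pose Ql (i : 'I_n) (J : {set 'I_n * 'I_n}) :=
  \sum_j graph_mx R J i j < (1 - del) * mu.
pose Qd (ST : {set 'I_n} * {set 'I_n}) (J : {set 'I_n * 'I_n}) :=
  [forall i, \sum_j graph_mx R J i j <= 2 * mu] &&
    (discrepancy_bound p g ST.1 ST.2 < edge_count (graph_mx R J) ST.1 ST.2).
pose Q1 J := [exists i, Qu i J].
pose Q2 J := [exists i, Ql i J].
pose Q3 J := [exists ST, Qd ST J].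
apply: (@le_trans _ _ (rset_pr (edge_pr p) (predU Q1 (predU Q2 Q3)))).
  apply: rset_pr_le => // J /=; apply: contraR.
  rewrite !negb_or => /and3P[/existsPn n1 /existsPn n2 /existsPn n3].
  have deg i : (1 - del) * mu <= \sum_j graph_mx R J i j <= (1 + del) * mu.
    by rewrite !leNgt; apply/andP; split; [exact: n2|exact: n1].
  apply/andP; split; first by apply/forallP => i; exact: deg.
  apply/forallP => ST.
  move: (n3 ST); rewrite negb_and -leNgt => /orP[/forallPn[i]|//].
  rewrite -ltNge => h; have /andP[_ h2] := deg i.
  have := lt_le_trans h h2; rewrite ltr_pM2r //; lra.
apply: (le_trans (rset_prU _ _ pi01)).
have -> : 2 * n%:R * expR (- (del ^+ 2 / 4 * mu)) + expR (- mu) =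
  n%:R * expR (- (del ^+ 2 / 4 * mu)) +
   (n%:R * expR (- (del ^+ 2 / 4 * mu)) + expR (- mu)) by ring.
apply: lerD.
  apply: (le_trans (rset_pr_union _ pi01)).
  rewrite -[n in leRHS]card_ord mulr_natl -sumr_const.
  by apply: ler_sum => i _; apply: degree_upper_tail => //; lra.
apply: (le_trans (rset_prU _ _ pi01)); apply: lerD.
  apply: (le_trans (rset_pr_union _ pi01)).
  rewrite -[n in leRHS]card_ord mulr_natl -sumr_const.
  by apply: ler_sum => i _; apply: degree_lower_tail.
apply: (le_trans (rset_pr_union _ pi01)).
set x := expR (- ln n%:R : R).
have xE : x = n%:R^-1 by rewrite /x expRN lnK.
apply: (@le_trans _ _ (\sum_(ST : {set 'I_n} * {set 'I_n})
   expR (- (4 * mu)) * (x ^+ #|ST.1| * x ^+ #|ST.2|))).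
  by apply: ler_sum => ST _; exact: discrepancy_tail.
rewrite -mulr_sumr -(pair_big xpredT xpredT (fun S T : {set 'I_n} => x ^+ #|S| * x ^+ #|T|)) /=.
under eq_bigr do rewrite -mulr_sumr.
rewrite -mulr_suml !sum_set_pow card_ord.
have h : (x + 1) ^+ n <= expR 1.
  have -> : expR (1 : R) = expR x ^+ n.
    by rewrite -expRM_natl xE divff // gt_eqF.
  rewrite lerXn2r ?nnegrE ?expR_ge0 ?addr_ge0 //; first exact: expR_ge0.
  by rewrite addrC expR_ge1Dx.
apply: (@le_trans _ _ (expR (- (4 * mu)) * (expR 1 * expR 1))).
  rewrite ler_wpM2l ?expR_ge0 //; apply: ler_pM => //;
  by rewrite exprn_ge0 ?addr_ge0 ?expR_ge0.
by rewrite -!expRD ler_expR; lra.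
Qed.

(** * The top eigenvector of a quasirandom graph *)

Lemma quasirandom_delocalized (R : realType) (n k : nat) (p del rho : R)
    (J : {set 'I_n * 'I_n}) (v : 'cV[R]_n) :
  0 < p -> 0 < del <= 1 / 32 -> 8 <= rho -> (15 <= n)%N ->
  n%:R <= (rho ^+ 2) ^+ k -> 4 * del * k%:R <= 1 / 2 ->
  quasirandom p del (5 * rho) J ->
  unit_top_eigenvector (graph_mx R J) v ->
  `|v| <= 11 / Num.sqrt n%:R.
Proof.
move=> p0 del0 rho8 n15 nk dk /andP[/forallP deg /forallP disc].
move=> [v1 [l [_ lmax] Av]].
set A := graph_mx R J in deg disc lmax Av.
have n1 : (15 : R) <= n%:R by rewrite ler_nat.
set mu := (n%:R - 1) * p in deg.
have mu0 : 0 < mu by rewrite mulr_gt0 //; lra.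
have Asym : A^T = A by apply/matrixP => i j; rewrite mxE graph_mx_sym.
have sumv : \sum_i v i 0 ^+ 2 = 1.
  rewrite -[LHS]sqr_sqrtr; last by apply: sumr_ge0 => i _; exact: sqr_ge0.
  by move: v1; rewrite /norm2 => ->; rewrite expr1n.
(* The all-ones vector has Rayleigh quotient equal to the average degree. *)
have l_ge : (1 - del) * mu <= l.
  pose e : 'cV[R]_n := const_mx 1.
  have eAe : (e^T *m A *m e) 0 0 = \sum_i \sum_j A i j.
    rewrite -mulmxA mxE; apply: eq_bigr => i _.
    rewrite [e^T _ _]mxE [e _ _]mxE mul1r [LHS]mxE.
    by apply: eq_bigr => j _; rewrite [e _ _]mxE mulr1.
  have ee : \sum_i e i 0 ^+ 2 = n%:R.
    rewrite (eq_bigr (fun=> 1)) => [|i _]; last by rewrite mxE expr1n.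
    by rewrite sumr_const card_ord.
  have := @rayleigh_le_largest_eigenvalue _ _ A l e _ Asym lmax.
  rewrite eAe ee.
  move=> /(_ (leq_trans (isT : (0 < 15)%N) n15)) h.
  have : (1 - del) * mu * n%:R <= l * n%:R.
    apply: le_trans h; rewrite -[n in leLHS]card_ord mulr_natr -sumr_const.
    by apply: ler_sum => i _; case/andP: (deg i).
  by rewrite ler_pM2r //; lra.
have l0 : 0 <= l by apply: le_trans l_ge; rewrite mulr_ge0 //; lra.
have entry i : `|v i 0| ^+ 2 <= 120 / n%:R.
  have := @subinvariant_delocalized _ n k A (fun i => `|v i 0|) mu del rho
    mu0 del0 rho8 n15 (graph_mx_ge0 R J).
  have sumv' : \sum_j `|v j 0| ^+ 2 = 1.
    by rewrite -sumv; apply: eq_bigr => j _; rewrite real_normK ?num_real.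
  rewrite sumv' mulr1; apply => //.
  - by move=> j; case/andP: (deg j).
  - move=> j; apply: (@le_trans _ _ (l * `|v j 0|)).
      by rewrite ler_wpM2r.
    have /matrixP /(_ j 0) := Av; rewrite !mxE => Avj.
    rewrite -[l]ger0_norm // -normrM -Avj.
    apply: le_trans (ler_norm_sum _ _ _) _; apply: ler_sum => j' _.
    by rewrite normrM ger0_norm // graph_mx_ge0.
  - move=> S T; have := disc (S, T); rewrite /discrepancy_bound /=.
    have -> : 3 * mu / (n%:R - 1) = 3 * p by rewrite /mu; field; lra.
    by [].
have sn0 : 0 < Num.sqrt (n%:R : R) by rewrite sqrtr_gt0; lra.
have b0 : 0 <= 11 / Num.sqrt (n%:R : R) by rewrite divr_ge0 // ltW.
rewrite [leLHS]/Num.Def.normr /= mx_normrE; apply: bigmax_le => // -[i j] _ /=.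
rewrite (ord1 j) -ler_sqr ?nnegrE //.
apply: le_trans (entry i) _; rewrite exprMn exprVn sqr_sqrtr; last by lra.
by rewrite ler_wpM2r ?invr_ge0; lra.
Qed.

Lemma adjacency_graph_mx (R : realType) (n : nat) (p : R)
    (u : 'I_n * 'I_n -> R) :
  adjacency p u = graph_mx R [set ij in @upper_pairs n | u ij < p]%SET.
Proof.
apply/matrixP => i j; rewrite !mxE.
case: ltngtP => [ij|ji|/val_inj ->]; last by rewrite eqxx.
- by rewrite /edge ij !inE /= ij (ltn_eqF ij : i == j = false).
- rewrite /edge ltnNge (ltnW ji) /= !inE /= ji.
  by rewrite (gtn_eqF ji : i == j = false).
Qed.

(** * Parameters and conclusion *)

(** The choices are rho = (np)^(1/6) and k = floor(3/L) + 1, so that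
    rho^(2k) = n^(kL/3) >= n while kL <= 4.  As 111^3 <= 2 * 835^2, the hypothesis
    on p gives 111 ln n <= rho^2; since np <= n, it also makes n large. *)
Lemma sparse_regime (R : realType) (n : nat) (p : R) :
  (7 <= n)%N -> 0 <= p <= 1 ->
  (2 * 835 ^+ 2) * ln n%:R ^+ 3 / n%:R <= p ->
  let L : R := ln (n%:R * p) / ln n%:R in
  exists rho : R, exists k : nat,
  [/\ (15 <= n)%N, 1 <= ln n%:R :> R, 1 <= (n%:R - 1) * p & 0 < L <= 1] /\
  [/\ 8 <= rho, 48 * (5 * rho) ^+ 2 * ln n%:R <= (n%:R - 1) * p,
      n%:R <= (rho ^+ 2) ^+ k & 4 * (L / 32) * k%:R <= 1 / 2].
Proof.
move=> n7 /andP[p0 p1] hp L.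
have n0 : (0 : R) < n%:R by rewrite ltr0n (leq_trans _ n7).
have n7' : (7 : R) <= n%:R by rewrite ler_nat.
set l : R := ln n%:R in hp L *.
have l1 : 1 <= l.
  rewrite -[leLHS]expRK ler_ln ?posrE ?expR_gt0 //.
  apply: le_trans n7'.
  have -> : (1 : R) = 3%:R * (1 / 3) by field.
  rewrite expRM_natl.
  have e3 := @expR_le_quadratic R (1 / 3) (lexx _).
  apply: (@le_trans _ _ ((3 / 2) ^+ 3)); last by lra.
  rewrite lerXn2r ?nnegrE ?expR_ge0 //; lra.
set X : R := n%:R * p in L *.
have X_ge : (2 * 835 ^+ 2) * l ^+ 3 <= X.
  by rewrite /X [leRHS]mulrC -ler_pdivrMr.
clear hp.
have l31 : 1 <= l ^+ 3 by rewrite exprn_ege1.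
have X1 : 10 ^+ 6 <= X by lra.
have X0 : 0 < X by lra.
have Xn : X <= n%:R by rewrite /X ler_piMr // ltW.
have lnX : 0 < ln X by rewrite ln_gt0 //; lra.
have L01 : 0 < L <= 1.
  rewrite divr_gt0 //=; last by lra.
  by rewrite ler_pdivrMr ?mul1r ?ler_ln ?posrE //; lra.
pose rho : R := expR (ln X / 6).
have rho0 : 0 < rho by exact: expR_gt0.
have rho6 : rho ^+ 6 = X.
  rewrite -[RHS]lnK; last by rewrite posrE.
  by rewrite -expRM_natl; congr expR; field.
have rho10 : 10 <= rho.
  have : (10 : R) ^+ 6 <= rho ^+ 6 by rewrite rho6.
  by rewrite ler_pXn2r ?nnegrE //; lra.
have l_rho : 111 * l <= rho ^+ 2.
  have : (111 * l) ^+ 3 <= (rho ^+ 2) ^+ 3.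
    by rewrite -exprM rho6 exprMn; lra.
  by rewrite ler_pXn2r ?nnegrE ?exprn_ge0 //; lra.
clear X_ge.
have mu_ge : X - 1 <= (n%:R - 1) * p by rewrite mulrBl mul1r -/X; lra.
exists rho, (Num.trunc (3 / L)).+1; split; split => //.
- by rewrite -(ler_nat R); lra.
- lra.
- lra.
- apply: le_trans mu_ge.
  have r2 : 100 <= rho ^+ 2.
    by have := ler_pM (ler0n _ 10) (ler0n _ 10) rho10 rho10; rewrite -expr2; lra.
  have r4 : rho ^+ 2 * (111 * l) <= rho ^+ 4.
    by rewrite (exprD _ 2 2) ler_wpM2l // sqr_ge0.
  have r6 : 100 * rho ^+ 4 <= X.
    by rewrite -rho6 (exprD _ 2 4) ler_wpM2r // exprn_ge0 // ltW.
  have r40 : 1 <= rho ^+ 4 by rewrite exprn_ege1 //; lra.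
  have -> : 48 * (5 * rho) ^+ 2 * l = 1200 / 111 * (rho ^+ 2 * (111 * l)).
    by field.
  lra.
- have -> : (n%:R : R) = expR l by rewrite lnK.
  have -> : rho ^+ 2 = expR (ln X / 3).
    by rewrite -expRM_natl; congr expR; field.
  rewrite -expRM_natl ler_expR.
  have h : 3 / L <= (Num.trunc (3 / L)).+1%:R by rewrite ltW ?truncnS_gt.
  have -> : l = 3 / L * (ln X / 3) by rewrite /L; field; lra.
  by rewrite ler_wpM2r // divr_ge0 // ltW.
- case/andP: L01 => L0 L1.
  have h : (Num.trunc (3 / L))%:R <= 3 / L.
    by rewrite truncn_le // divr_ge0 // ltW.
  have h2 : L * (Num.trunc (3 / L))%:R <= 3.
    by rewrite mulrC -ler_pdivlMr.
  rewrite -[_.+1%:R]natr1 /=; lra.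
Qed.

(** Both exponential rates, L^2 / 4096 and 1, are at least L^2 / 4704, and
    2 n + 1 <= 4 (n - 1). *)
Lemma failure_budget (R : realType) (n L mu : R) :
  7 <= n -> 0 < L <= 1 -> 0 <= mu ->
  2 * n * expR (- ((L / 32) ^+ 2 / 4 * mu)) + expR (- mu) <=
  4 * (n - 1) * expR (- (L ^+ 2 * mu / 4704)).
Proof.
move=> n7 /andP[L0 L1] mu0.
have L2 : L ^+ 2 <= 1 by rewrite exprn_ile1 // ltW.
have L2mu : L ^+ 2 * mu <= mu by rewrite ler_piMl.
have L2mu0 : 0 <= L ^+ 2 * mu by rewrite mulr_ge0 // sqr_ge0.
set e := expR (- (L ^+ 2 * mu / 4704)).
have e1 : expR (- ((L / 32) ^+ 2 / 4 * mu)) <= e.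
  rewrite ler_expR lerN2.
  have -> : (L / 32) ^+ 2 / 4 * mu = L ^+ 2 * mu / 4096 by field.
  by lra.
have e2 : expR (- mu) <= e by rewrite ler_expR; lra.
have e0 : 0 <= e by exact: expR_ge0.
have h1 : 2 * n * expR (- ((L / 32) ^+ 2 / 4 * mu)) <= 2 * n * e.
  by rewrite ler_wpM2l //; lra.
have h2 : (2 * n + 1) * e <= 4 * (n - 1) * e by rewrite ler_wpM2r //; lra.
lra.
Qed.

Theorem lemma3 (d : measure_display) (T : measurableType d) (R : realType)
    (P : probability T R) (n : nat) (hn : (7 <= n)%N)
    (U : 'I_n * 'I_n -> {RV P >-> R})
    (Uindep : independent_on (@upper_pairs n) U)
    (Uunif : forall ij, ij \in @upper_pairs n -> uniform01 (U ij))
    (p : R) (p01 : 0 <= p <= 1)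
    (hp : (2 * 835 ^+ 2) * ln n%:R ^+ 3 / n%:R <= p) :
  let E : set T := [set w | forall v : 'cV[R]_n,
      unit_top_eigenvector (adjacency p (fun ij => U ij w)) v ->
      `|v| <= 11 / Num.sqrt n%:R] in
  let c : R := 1 / 9408 in
  measurable E /\
  ((1 - 4 * (n%:R - 1) *
      expR (- 2 * c * (ln (n%:R * p) / ln n%:R) ^+ 2 * (n%:R - 1) * p))%:E
    <= P E)%E.
Proof.
move=> E c.
pose Q (J : {set 'I_n * 'I_n}) : bool :=
  `[< forall v, unit_top_eigenvector (graph_mx R J) v ->
        `|v| <= 11 / Num.sqrt (n%:R : R) >].
have [mE PE] := threshold_set_law Q p01 Uindep Uunif.
have EE : E = [set w | Q [set ij in @upper_pairs n | U ij w < p]%SET].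
  by apply/seteqP; split => w /= h; [apply/asboolP | move/asboolP: h];
    rewrite -adjacency_graph_mx.
rewrite EE; split => //; rewrite PE lee_fin -/(edge_pr p).
have [rho [k [[n15 ln1 mu1 L01] [rho8 hrho nk dk]]]] := sparse_regime hn p01 hp.
clear hp.
have [L0 L1] := andP L01.
have del01 : 0 < ln (n%:R * p) / ln n%:R / 32 <= 1 / 32.
  by rewrite divr_gt0 ?ler_wpM2r.
have p0 : 0 < p.
  rewrite lt_neqAle eq_sym; case/andP: p01 => -> _; rewrite andbT.
  by apply/eqP => p00; move: mu1; rewrite p00 mulr0 ler10.
have -> : - 2 * c * (ln (n%:R * p) / ln n%:R) ^+ 2 * (n%:R - 1) * p =
    - ((ln (n%:R * p) / ln n%:R) ^+ 2 * ((n%:R - 1) * p) / 4704).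
  by rewrite /c; field; rewrite gt_eqF // (lt_le_trans ltr01).
set L := ln (n%:R * p) / ln n%:R in L0 L1 L01 del01 dk *.
rewrite rset_prC lerD2l lerN2.
apply: le_trans (failure_budget _ L01 (le_trans ler01 mu1)); last first.
  by rewrite (ler_nat R 7).
apply: le_trans (quasirandom_pr p01 mu1 _ _ ln1 hrho).
- apply: rset_pr_le => [e|J /=]; first exact: edge_pr01.
  apply: contra => qJ; apply/asboolP => v.
  exact: (quasirandom_delocalized p0 del01 rho8 n15 nk dk qJ).
- case/andP: del01 => del0 del32.
  by rewrite (ltW del0) (le_trans del32) // ler_wpM2l // lef_pV2 ?posrE ?ler_nat.
- by rewrite mulr_gt0 // (lt_le_trans _ rho8).
Qed.
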